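(* Let $(C_\alpha)_{\alpha\in A}$ be a net of random closed sets in $E$, $C_\alpha$ being defined on a probability space $(\Omega_\alpha,\mathcal{A}_\alpha,\mathbb{P}_\alpha)$, and let $C$ be a random closed set in $E$ on a probability space $(\Omega,\mathcal{A},\mathbb{P})$. The following statements are equivalent: (i) $C_\alpha \stackrel{\mathcal{D}}{\rightarrow} C$ in $(\mathcal{F},\tau_{uF})$. (ii) $$\limsup_\alpha \mathbb{P}_\alpha(C_\alpha \cap K_1\neq \emptyset,\ldots, C_\alpha \cap K_m \neq \emptyset) \le \mathbb{P}(C \cap K_1\neq \emptyset,\ldots, C \cap K_m \neq \emptyset)$$ for every $m \in \mathbb{N}$ and every finite collection $K_1,\ldots,K_m$ of non-empty compact sets in $E$. (iii) The inequality in (ii) holds for every $m \in \mathbb{N}$ and every finite collection $K_1,\ldots,K_m$ of non-empty compact sets in $E$ such that $\mathbb{P}(C \in \partial_F \mathcal{H}(K_i))=0$ for all $1 \le i \le m$.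
   Context: $(E,\mathcal{G})$ is a non-empty locally compact, second-countable Hausdorff space; $\mathcal{G}$ is the family of its open sets, and $\mathcal{F}$ and $\mathcal{K}$ are the families of all closed and all compact subsets of $E$. For $A\subseteq E$ put $\mathcal{M}(A)=\{F\in\mathcal{F}: F\cap A=\emptyset\}$ and $\mathcal{H}(A)=\{F\in\mathcal{F}: F\cap A\neq\emptyset\}$. The Fell topology $\tau_F$ on $\mathcal{F}$ is generated by $\{\mathcal{M}(K):K\in\mathcal{K}\}\cup\{\mathcal{H}(G):G\in\mathcal{G}\}$; the upper Fell topology $\tau_{uF}$ on $\mathcal{F}$ is generated by $\{\mathcal{M}(K):K\in\mathcal{K}\}$. Their Borel $\sigma$-algebras coincide: $\mathcal{B}_F:=\sigma(\tau_F)=\sigma(\tau_{uF})$. For $\mathbf{A}\subseteq\mathcal{F}$, $\partial_F\mathbf{A}$ denotes the boundary of $\mathbf{A}$ with respect to $\tau_F$. Weak convergence: for a topological space $(X,\mathcal{O})$ and a net $(P_\alpha)_{\alpha\in A}$ ($A$ a directed set) of probability measures and a probability measure $P$ on $(X,\sigma(\mathcal{O}))$, $P_\alpha\rightarrow_w P$ on $(X,\mathcal{O})$ means convergence in the weak topology (the initial topology with respect to the maps $P\mapsto P(O)$, $O\in\mathcal{O}$, into $\mathbb{R}$ with the topology $\{(a,\infty):a\in\mathbb{R}\}\cup\{\emptyset,\mathbb{R}\}$); equivalently, $\liminf_\alpha P_\alpha(O)\ge P(O)$ for all $O\in\mathcal{O}$. A random closed set in $E$ on a probability space $(\Omega,\mathcal{A},\mathbb{P})$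 is an $\mathcal{A}$-$\mathcal{B}_F$ measurable map $C:\Omega\to\mathcal{F}$. $C_\alpha \stackrel{\mathcal{D}}{\rightarrow} C$ in $(\mathcal{F},\tau_{uF})$ means $\mathbb{P}_\alpha\circ C_\alpha^{-1}\rightarrow_w \mathbb{P}\circ C^{-1}$ on $(\mathcal{F},\tau_{uF})$. *)

(* Defs.v *)
From HB Require Import structures.
From mathcomp Require Import all_boot all_order all_algebra.
From mathcomp Require Import all_classical all_reals all_analysis.

Set Implicit Arguments.
Unset Strict Implicit.
Unset Printing Implicit Defensive.

Import Order.TTheory GRing.Theory Num.Theory.

Local Open Scope classical_set_scope.
Local Open Scope ring_scope.

Section nets.
Context {A : Type}.
Implicit Types le : A -> A -> Prop.

Definition directed le :=
  [/\ [set: A] !=set0,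
      forall a, le a a,
      forall a b c, le a b -> le b c -> le a c
    & forall a b, exists c, le a c /\ le b c].

Definition tails le : set_system A := filter_from [set: A] (fun a => le a).

Definition net_limsup {R : realType} le (x : A -> \bar R) : \bar R :=
  ereal_inf [set ereal_sup (x @` le a) | a in [set: A]].

End nets.

Definition right_order (R : realType) : Type := R.

Section right_order_topology.
Context {R : realType}.

Definition right_order_open (U : set R) :=
  [\/ U = set0, U = setT | exists a : R, U = [set x | a < x]].

Let right_order_openT : right_order_open setT.
Proof. by constructor 2. Qed.

Let right_order_openI : setI_closed right_order_open.
Proof.
move=> U V [->|->|[a ->]]; first by rewrite set0I; constructor 1.
  by rewrite setTI.
move=> [->|->|[b ->]]; first by rewrite setI0; constructor 1.
  by rewrite setIT; constructor 3; exists a.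
constructor 3; exists (Num.max a b); apply/seteqP; split=> x /=.
  by move=> [ax bx]; rewrite gt_max ax bx.
by rewrite gt_max => /andP[].
Qed.

Let right_order_open_bigU (I : Type) (f : I -> set R) :
  (forall i, right_order_open (f i)) -> right_order_open (\bigcup_i f i).
Proof.
move=> fo.
have up i x y : f i x -> x < y -> f i y.
  by case: (fo i) => [->|->|[a ->]] //= ax xy; exact: lt_trans xy.
have opn i x : f i x -> exists2 y, y < x & f i y.
  case: (fo i) => [->//|->|[a ->]/= ax]; first by exists (x - 1) => //; rewrite gtrBl.
  by exists ((a + x) / 2); have := midf_lt ax; case.
set U := \bigcup_i f i.
have [->|/set0P U0] := eqVneq U set0; first by constructor 1.
have [lbU|nlbU] := pselect (has_lbound U); last first.
  constructor 2; rewrite -subTset => x _; apply: contrapT => nUx; apply: nlbU.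
  exists x => y [i _ fiy]; rewrite leNgt; apply/negP => yx.
  by apply: nUx; exists i => //; exact: up yx.
constructor 3; exists (inf U); apply/seteqP; split=> x /=.
  move=> [i _ /opn[y yx fiy]]; apply: le_lt_trans yx.
  by apply: ge_inf => //; exists i.
move=> /(inf_lt U0)[y [i _ fiy] yx].
by exists i => //; exact: up yx.
Qed.

HB.instance Definition _ := Choice.on (right_order R).
HB.instance Definition _ := isOpenTopological.Build (right_order R)
  right_order_openT right_order_openI right_order_open_bigU.

End right_order_topology.

Notation borel X := (g_sigma_algebraType (@open X)).

(* The initial topology for the maps P |-> P O, O open; sup_topology of
   initial topologies as in the definition of prod_topology. *)
Definition weak_probability (X : ptopologicalType) (R : realType) : Type :=
  sup_topology (fun O : {O : set X | open O} => Topological.class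
    (initial_topology
      (fun P : probability (borel X) R => fine (P (sval O)) : right_order R))).

HB.instance Definition _ (X : ptopologicalType) (R : realType) :=
  Topological.on (weak_probability X R).

Definition weak_cvg {X : ptopologicalType} {R : realType} {A : Type}
    (le : A -> A -> Prop) (Pn : A -> probability (borel X) R)
    (P : probability (borel X) R) :=
  (fun a => Pn a : weak_probability X R) @ tails le
    --> (P : weak_probability X R).

Definition closed_sets (E : topologicalType) : Type := {F : set E | closed F}.

Definition set_of_closed (E : topologicalType) (F : closed_sets E) : set E :=
  sval F.
Coercion set_of_closed : closed_sets >-> set.

HB.instance Definition _ (E : topologicalType) := gen_eqMixin (closed_sets E).
HB.instance Definition _ (E : topologicalType) :=
  gen_choiceMixin (closed_sets E).
HB.instance Definition _ (E : topologicalType) :=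
  isPointed.Build (closed_sets E) (exist closed set0 (@closed0 E)).

Definition miss {E : topologicalType} (B : set E) : set (closed_sets E) :=
  [set F : closed_sets E | F `&` B = set0].

Definition hit {E : topologicalType} (B : set E) : set (closed_sets E) :=
  [set F : closed_sets E | F `&` B !=set0].

Definition upper_fell_subbase (E : topologicalType) :
  set (set (closed_sets E)) := [set miss K | K in compact].

Definition fell_subbase (E : topologicalType) : set (set (closed_sets E)) :=
  [set miss K | K in compact] `|` [set hit G | G in open].

Definition fell (E : topologicalType) : Type := closed_sets E.
HB.instance Definition _ (E : topologicalType) := Pointed.on (fell E).
HB.instance Definition _ (E : topologicalType) :=
  isSubBaseTopological.Build (fell E) (@fell_subbase E) id.

Definition upper_fell (E : topologicalType) : Type := closed_sets E.
HB.instance Definition _ (E : topologicalType) := Pointed.on (upper_fell E).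
HB.instance Definition _ (E : topologicalType) :=
  isSubBaseTopological.Build (upper_fell E) (@upper_fell_subbase E) id.

Definition fell_boundary {E : topologicalType} (S : set (closed_sets E)) :
  set (closed_sets E) := closure (S : set (fell E)) `\` interior (S : set (fell E)).

Notation random_closed_set E P := {RV P >-> borel (fell E)}.

Definition to_upper {E : topologicalType} (F : borel (fell E)) :
  borel (upper_fell E) := F.

Lemma upper_fell_open_fell (E : topologicalType) (U : set (closed_sets E)) :
  open (U : set (upper_fell E)) -> open (U : set (fell E)).
Proof.
move=> [D' D'sub <-]; exists D' => // V /D'sub[D Dsub <-].
by exists D => // i /Dsub; rewrite !inE => ?; left.
Qed.

Lemma measurable_to_upper (E : topologicalType) :
  measurable_fun [set: borel (fell E)] (@to_upper E).
Proof.
move=> _ B mB; rewrite setTI.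
exact: (sub_sigma_algebra2 (@upper_fell_open_fell E) mB).
Qed.

HB.instance Definition _ (E : topologicalType) :=
  isMeasurableFun.Build _ _ _ _ (@to_upper E) (@measurable_to_upper E).

(* A random closed set is measurable for the Borel sets of the Fell topology;
   convergence in the upper Fell topology concerns its law on the Borel sets of
   that topology, which form a sub-sigma-algebra (in fact the same one when E is
   locally compact, second countable and Hausdorff). *)
Definition upper_law {E : topologicalType} {R : realType} {d : measure_display}
    {Omega : measurableType d} {P : probability Omega R}
    (C : random_closed_set E P) : probability (borel (upper_fell E)) R :=
  distribution P (to_upper \o C).

Definition cvg_distribution {E : topologicalType} {R : realType} {A : Type}
    (le : A -> A -> Prop) {da : A -> measure_display}
    {Omegaa : forall a, measurableType (da a)}
    {Pa : forall a, probability (Omegaa a) R}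
    (Ca : forall a, random_closed_set E (Pa a))
    {d : measure_display} {Omega : measurableType d} {P : probability Omega R}
    (C : random_closed_set E P) :=
  weak_cvg le (fun a => upper_law (Ca a)) (upper_law C).

Definition hits_all {E : topologicalType} {R : realType} {d : measure_display}
    {Omega : measurableType d} {P : probability Omega R}
    (C : random_closed_set E P) {m : nat} (K : 'I_m -> set E) : set Omega :=
  [set w | forall i, hit (K i) (C w)].

(* Main.v *)
Require Import Defs.
From HB Require Import structures.
From mathcomp Require Import all_boot all_order all_algebra finmap lra.
From mathcomp Require Import all_classical all_reals all_analysis.
From mathcomp Require Import measurable_realfun.

Set Implicit Arguments.
Unset Strict Implicit.
Unset Printing Implicit Defensive.

Import Order.TTheory GRing.Theory Num.Theory.
Import numFieldNormedType.Exports.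

Local Open Scope classical_set_scope.
Local Open Scope ring_scope.

(** Writing miss B and hit B for the sets of closed sets that miss and that hit
    B, the event that C hits all of K_1, ..., K_m is the complement of the event
    that C belongs to the upper Fell open set which is the union of the
    miss K_i. Convergence in distribution bounds the liminf of the probabilities
    of such open sets from below; taking complements gives the limsup inequality
    for arbitrary compact sets ([cvg_distribution_hits_all]), and restricting it
    to sets K_i with null boundary event is trivial.

    For the converse ([hits_all_cvg_distribution]), let O be open in the upper
    Fell topology. It suffices to write O as a countable union of sets miss K
    where K is a compact set whose hitting set has a P-null boundary (a
    continuity compact): by continuity from below, a finite subunion already has
    probability close to that of O, and the inequality for the complement of this
    subunion, which is an event of the form considered, gives the lower bound on
    the liminf.

    That many continuity compacts exist relies on local compactness. Given a
    neighbourhood U of x, Urysohn's lemma provides a continuous f >= 0 that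
    vanishes at x and is equal to 1 off a subset of U with compact closure. The
    real random variable X, the infimum of 1 and of the values of f on C,
    satisfies X = t whenever C lies in the boundary of hit {f <= t}, with t < 1
    ([fell_boundary_level]). As X has at most countably many atoms, some t in
    ]0, 1[ is not one of them, and then {f <= t} is a continuity compact
    ([continuity_compact_level]). Finite unions of continuity compacts are
    continuity compacts, so inserting such sets between the members of a
    countable base of E and taking finite unions yields countably many continuity
    compacts Q_n for which the sets miss Q_n form a base of the upper Fell
    topology ([countable_continuity_compacts]). *)

(** * Nets and weak convergence *)

Section weak_convergence.
Context {A : Type} (le : A -> A -> Prop) (led : directed le).

Lemma tails_filter : Filter (tails le).
Proof.
case: led => A0 lexx letrans lejoin.
apply: filter_from_filter; first by case: A0 => a _; exists a.
move=> a b _ _; have [c [ac bc]] := lejoin a b.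
by exists c => // x cx; split; exact: letrans cx.
Qed.

Lemma net_limsup_lt {R : realType} (x : A -> \bar R) r :
  (net_limsup le x < r)%E -> \forall a \near tails le, (x a < r)%E.
Proof.
case/ereal_inf_lt => _ [a _ <-] xr; exists a => // b ab /=.
by apply: le_lt_trans xr; apply: ereal_sup_ubound; exists b.
Qed.

Lemma net_limsup_le {R : realType} (x : A -> \bar R) r :
  (\forall a \near tails le, (x a <= r)%E) -> (net_limsup le x <= r)%E.
Proof.
move=> [a _ xr]; apply: ge_ereal_inf; exists (ereal_sup (x @` le a)).
  by exists a.
by apply: ge_ereal_sup => _ [b ab <-]; exact: xr.
Qed.

(** The characterization of weak convergence by liminf Pn(O) >= P(O) for open O,
    with the liminf unfolded. *)
Lemma weak_cvgP {X : ptopologicalType} {R : realType}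
    (Pn : A -> probability (borel X) R) (P : probability (borel X) R) :
  weak_cvg le Pn P <->
  forall (O : set X) (r : R), open O -> (r%:E < P O)%E ->
    \forall a \near tails le, (r%:E < Pn a O)%E.
Proof.
have tF := tails_filter.
have finP (Q : probability (borel X) R) (O : set X) (r : R) : open O ->
    (r%:E < Q O)%E = (r < fine (Q O)).
  move=> oO; rewrite -lte_fin fineK// fin_num_measure//.
  exact: sub_sigma_algebra.
split=> [cvP O r oO rP | H].
  move/cvg_sup/(_ (exist _ O oO)): cvP.
  move/(_ [set Q : probability (borel X) R | (r%:E < Q O)%E]); apply.
  apply: open_nbhs_nbhs; split => //=.
  exists [set x : right_order R | (r < x)%R]; first by constructor 3; exists r.
  by apply/seteqP; split=> Q /=; rewrite finP.
apply/cvg_sup => -[ O oO] U [V [[W oW <-] WP] WU].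
simpl in WP, WU.
case: oW WP WU => [->//|-> _ WU|[r ->] rP WU].
  apply: filterS (@filterT _ _ tF) => a _; exact: WU.
have := H O r oO; rewrite finP// => /(_ rP); apply: filterS => a.
by rewrite finP// => ra; exact: WU.
Qed.

End weak_convergence.

(** * The Fell and upper Fell topologies *)

Section fell_topology.
Context {E : topologicalType}.
Implicit Types (K G B : set E) (F : closed_sets E).

Lemma hitC B : ~` hit B = miss B.
Proof. by apply/seteqP; split=> F /= => [/nonemptyPn|/nonemptyPn]. Qed.

Lemma hitU B1 B2 : hit (B1 `|` B2) = hit B1 `|` hit B2.
Proof.
apply/seteqP; split=> F /=.
  by move=> [x [Fx [?|?]]]; [left|right]; exists x.
by move=> [|] [x [Fx Bx]]; exists x; split=> //; [left|right].
Qed.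

Lemma hitS B1 B2 : B1 `<=` B2 -> hit B1 `<=` hit B2.
Proof. by move=> B12 F [x [Fx Bx]]; exists x; split => //; exact: B12. Qed.

Lemma missS B1 B2 : B1 `<=` B2 -> miss B2 `<=` miss B1.
Proof. by move=> B12; rewrite -!hitC; apply: subsetC; exact: hitS. Qed.

Lemma open_upper_fell_miss K : compact K -> open (miss K : set (upper_fell E)).
Proof.
move=> cK; exists [set miss K]; last by rewrite bigcup_set1.
move=> _ ->; exists [fset (@miss E K)]%fset.
  by move=> V; rewrite in_fset1 => /eqP VK; rewrite inE VK; exists K.
by rewrite set_fset1 bigcap_set1.
Qed.

Lemma open_fell_miss K : compact K -> open (miss K : set (fell E)).
Proof.
by move=> cK; apply: upper_fell_open_fell; exact: open_upper_fell_miss.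
Qed.

Lemma closed_fell_hit K : compact K -> closed (hit K : set (fell E)).
Proof. by move=> cK; rewrite -openC hitC; exact: open_fell_miss. Qed.

Lemma open_fell_hit G : open G -> open (hit G : set (fell E)).
Proof.
move=> oG; exists [set hit G]; last by rewrite bigcup_set1.
move=> _ ->; exists [fset (@hit E G)]%fset.
  by move=> V; rewrite in_fset1 => /eqP VK; rewrite inE VK; right; exists G.
by rewrite set_fset1 bigcap_set1.
Qed.

(** The sets [miss K], K compact, form a base and not only a subbase, because
    missing finitely many compact sets amounts to missing their union. *)
Lemma upper_fell_base (O : set (upper_fell E)) (F : closed_sets E) :
  open O -> O F -> exists K, [/\ compact K, miss K F & miss K `<=` O].
Proof.
move=> [D' D'sub <-] [V D'V VF]; have [D Dsub DV] := D'sub _ D'V.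
have {}DV : \bigcap_(U in [set` D]) U = V := DV.
have /choice[k kP] (U : set (closed_sets E)) :
    exists K, U \in D -> compact K /\ miss K = U.
  have [/Dsub|] := boolP (U \in D); last by exists set0.
  by rewrite inE => -[K cK <-]; exists K.
have kS U : U \in D -> k U `<=` \big[setU/set0]_(i <- D) k i.
  by move=> UD; rewrite -bigcup_seq => x kx; exists U.
exists (\big[setU/set0]_(i <- D) k i); split.
- by rewrite big_seq_cond; apply: bigsetU_compact => U /andP[/kP[]].
- rewrite /miss/= -bigcup_seq setI_bigcupr bigcup0// => U UD.
  have [_ eU] := kP U UD.
  by move: VF; rewrite -DV => /(_ U UD)/=; rewrite -{1}eU.
- move=> F' F'm; exists V => //=; rewrite -DV => U UD.
  by have [_ eU] := kP U UD; rewrite /= -eU; exact: missS (kS _ UD) _ F'm.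
Qed.

Lemma measurable_open_fell (O : set (fell E)) :
  open O -> measurable (O : set (borel (fell E))).
Proof. exact: sub_sigma_algebra. Qed.

Lemma measurable_fell_boundary (S : set (closed_sets E)) :
  measurable (fell_boundary S : set (borel (fell E))).
Proof.
apply: measurableD; last by apply: measurable_open_fell; exact: open_interior.
rewrite -[closure _]setCK; apply: measurableC; apply: measurable_open_fell.
by rewrite openC; exact: closed_closure.
Qed.

Lemma fell_boundaryU (S T : set (closed_sets E)) :
  fell_boundary (S `|` T) `<=` fell_boundary S `|` fell_boundary T.
Proof.
rewrite /fell_boundary closureU => F [[SF|TF]] nST.
  left; split => // iS; apply: nST; exact: (@interiorS (fell E) S) iS.
right; split => // iT; apply: nST; exact: (@interiorS (fell E) T) iT.
Qed.

Lemma fell_boundary0 : fell_boundary (@set0 (closed_sets E)) = set0.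
Proof. by rewrite /fell_boundary closure0 set0D. Qed.

(** [hit K] is closed and [hit G] is an open subset of it. *)
Lemma fell_boundary_hit_sub K G : compact K -> open G -> G `<=` K ->
  fell_boundary (hit K) `<=` hit K `\` hit G.
Proof.
move=> cK oG GK F [+ nI].
rewrite -(closure_id _).1; last exact: closed_fell_hit.
move=> hK; split=> // hG; apply: nI.
exists (hit G); split => //; first exact: open_fell_hit.
exact: hitS.
Qed.

End fell_topology.

(** * Coverings of compact sets *)

Lemma compact_finite_subset_cover (E : topologicalType) (K : set E) :
  compact K -> cover_compact K.
Proof.
move=> cK; have [->|/set0P[x _]] := eqVneq K set0.
  by move=> I D f _ _; exists fset0 => // x; rewrite inE.
(* the covering characterization of compactness is stated for pointed spaces *)
pose E' : ptopologicalType := HB.pack E (isPointed.Build E x).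
have {}cK : @compact E' K by [].
by rewrite compact_cover in cK.
Qed.

(** * The lowest level at which a closed set hits a function *)

Section hitting_level.
Context {R : realType} {E : topologicalType}.

(** The infimum of [f] on [F], capped at 1. Adding the value 1 gives the empty
    set the level 1 instead of the default infimum, so that the level is below
    [t <= 1] exactly when [F] hits [{f < t}]. *)
Definition hitting_level (f : E -> R) (F : closed_sets E) : R :=
  inf (f @` F `|` [set 1]).

Context (f : E -> R) (f_cont : continuous f) (f_ge0 : forall x, 0 <= f x).

Lemma hitting_levelP (F : closed_sets E) (t : R) : t <= 1 ->
  hitting_level f F < t <-> hit [set x | f x < t] F.
Proof.
move=> t1.
have lbF : has_lbound (f @` F `|` [set 1]).
  by exists 0 => _ [[x _ <-]|->].
split=> [|[x [Fx /= fxt]]].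
  move=> /inf_lt[]; first by exists 1; right.
  move=> _ [[x Fx <-] fxt|-> lt1t]; first by exists x.
  by move: lt1t; rewrite ltNge t1.
by apply: le_lt_trans fxt; apply: ge_inf => //; left; exists x.
Qed.

Lemma measurable_hitting_level :
  measurable_fun setT (hitting_level f : borel (fell E) -> R).
Proof.
apply: (measurability _ (@RGenInftyO.measurableE R)) => //= _ [_ [t ->] <-].
rewrite setTI; have [t1|lt1t] := leP t 1.
  rewrite (_ : _ @^-1` _ = hit [set x | f x < t]).
    apply: measurable_open_fell; apply: open_fell_hit.
    exact: (open_comp _ (@open_lt _ t)).
  by apply/seteqP; split=> F /=; rewrite in_itv/= => /hitting_levelP; apply.
rewrite (_ : _ @^-1` _ = setT); first exact: measurableT.
apply/seteqP; split=> F //= _; rewrite in_itv/=.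
apply: le_lt_trans lt1t; apply: ge_inf; last by right.
by exists 0 => _ [[x _ <-]|->].
Qed.

(** A closed set in the boundary of [hit {f <= t}] hits [{f <= t}] and misses
    [{f < t}], so that the infimum of [f] on it is [t]. *)
Lemma fell_boundary_level (t : R) : t < 1 -> compact [set x | f x <= t] ->
  fell_boundary (hit [set x | f x <= t]) `<=` hitting_level f @^-1` [set t].
Proof.
move=> t1 ct F bF; apply/eqP; rewrite eq_le; apply/andP; split; last first.
  have [_ nF] := fell_boundary_hit_sub ct
    (open_comp (in1W f_cont) (@open_lt _ t)) (fun x => @ltW _ _ _ _) bF.
  by rewrite leNgt; apply/negP => /hitting_levelP-/(_ (ltW t1)); exact: nF.
have [[x [Fx /= fxt]] _] := fell_boundary_hit_sub ct open0 (@sub0set _ _) bF.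
apply: le_trans fxt; apply: ge_inf; last by left; exists x.
by exists 0 => _ [[y _ <-]|->].
Qed.

End hitting_level.

(** * Continuity compacts *)

Section continuity_compacts.
Context {R : realType} {E : topologicalType} {d : measure_display}
  {Omega : measurableType d} {P : probability Omega R}
  (C : random_closed_set E P).

(** A compact set [K] such that [hit K] is a continuity set, for the Fell
    topology, of the law of [C]. *)
Definition continuity_compact (K : set E) :=
  compact K /\ P (C @^-1` fell_boundary (hit K)) = 0%E.

Lemma random_closed_set_measurable (S : set (closed_sets E)) :
  measurable (S : set (borel (fell E))) -> measurable (C @^-1` S).
Proof. by move=> mS; exact: measurable_funPTI. Qed.

Lemma continuity_compact0 : continuity_compact set0.
Proof.
split; first exact: compact0.
rewrite (_ : hit set0 = set0) ?fell_boundary0 ?preimage_set0 ?measure0//.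
by apply/seteqP; split=> F // [x []].
Qed.

Lemma continuity_compactU (K L : set E) :
  continuity_compact K -> continuity_compact L -> continuity_compact (K `|` L).
Proof.
move=> [cK K0] [cL L0]; split; first exact: compactU.
have mB S := random_closed_set_measurable (measurable_fell_boundary S).
apply: (@subset_measure0 _ _ _ P _
  (C @^-1` fell_boundary (hit K) `|` C @^-1` fell_boundary (hit L))) => //.
- by apply: measurableU.
- by rewrite -preimage_setU hitU; apply: preimage_subset; exact: fell_boundaryU.
- by apply: null_set_setU.
Qed.

Lemma continuity_compact_bigsetU (I : Type) (s : seq I) (K : I -> set E) :
  (forall i, continuity_compact (K i)) ->
  continuity_compact (\big[setU/set0]_(i <- s) K i).
Proof.
by move=> cK; elim/big_ind : _ => //;
  [exact: continuity_compact0|exact: continuity_compactU].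
Qed.

(** The hitting level of [C] has at most countably many atoms, so some [t] in
    ]0, 1[ is not an atom. *)
Lemma continuity_compact_level (f : E -> R) :
  continuous f -> (forall x, 0 <= f x) ->
  (forall t, t < 1 -> compact [set x | f x <= t]) ->
  exists2 t, 0 < t < 1 & continuity_compact [set x | f x <= t].
Proof.
move=> f_cont f_ge0 cf.
have mX : measurable_fun setT (hitting_level f \o C).
  apply: measurableT_comp => //; exact: measurable_hitting_level.
pose X : {RV P >-> R} := mfun_Sub (mem_set mX).
have [t /= /[!in_itv]/= t01 nt] :
    exists2 t : R, `]0, 1[%classic t & ~ [set r | 0 < pmf X r] t.
  apply: contrapT => noth.
  have : countable `](0:R), (1:R)[%classic.
    apply: (sub_countable _ (pmf_gt0_countable X)).
    apply: subset_card_le => t t01.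
    by apply: contrapT => nt; apply: noth; exists t.
  move=> /(@countable_lebesgue_measure0 R)/eqP.
  rewrite lebesgue_measure_itv/= lte_fin ltr01 oppr0 adde0 eqe oner_eq0.
  by [].
have /andP[_ t1] := t01.
exists t => //; split; first exact: cf.
apply: (@subset_measure0 _ _ _ P _ (X @^-1` [set t])).
- exact: random_closed_set_measurable (measurable_fell_boundary _).
- exact: measurable_funPTI.
- by move=> w; exact: fell_boundary_level (cf _ t1) (C w).
- have := pmf_ge0 X t; rewrite le_eqVlt => /orP[|//]; rewrite /pmf eq_sym.
  by rewrite fine_eq0 ?fin_num_measure// => /eqP.
Qed.

Lemma continuity_compact_nbhs (x : E) (U : set E) :
  locally_compact [set: E] -> hausdorff_space E -> nbhs x U ->
  exists K, [/\ continuity_compact K, nbhs x K & K `<=` U].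
Proof.
move=> lcE hE xU.
have [V] := lcE x Logic.I; rewrite withinET => xV [cV clV].
have xUV : (U `&` V)^° x by apply: filterI.
have /(@uniform_separatorP _ R)[f [f_cont f01 fx fUV]] :
    uniform_separator [set x] (~` (U `&` V)^°).
  apply: (locally_compact_completely_regular (R := R) lcE hE).
    by rewrite closedC; exact: open_interior.
  by move=> /(_ xUV).
have f_ge0 y : 0 <= f y.
  by have := f01 (f y) (imageT f y); rewrite /= in_itv/= => /andP[].
have fUVsub t : t < 1 -> [set y | f y <= t] `<=` U `&` V.
  move=> t1 y /= fyt; apply: (@interior_subset _ (U `&` V)).
  apply: contrapT => nUVy.
  by move: fyt; rewrite (fUV _ (ex_intro2 _ _ y nUVy erefl)) leNgt t1.
have cf t : t < 1 -> compact [set y | f y <= t].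
  move=> t1; apply: (subclosed_compact _ cV); last first.
    by move=> y /(fUVsub _ t1)[].
  exact: (closed_comp (in1W f_cont) (@closed_le _ t)).
have [t /andP[t0 t1] ct] := continuity_compact_level f_cont f_ge0 cf.
exists [set y | f y <= t]; split => //; last first.
  by move=> y /(fUVsub _ t1)[].
apply: (@filterS _ _ _ [set y | f y < t]); first by move=> y /ltW.
apply: open_nbhs_nbhs; split => /=; last first.
  by rewrite (fx _ (ex_intro2 _ _ x erefl erefl)).
exact: (open_comp (in1W f_cont) (@open_lt _ t)).
Qed.

(** The sets [miss (Q n)] form a countable base of the upper Fell topology. *)
Lemma countable_continuity_compacts :
  locally_compact [set: E] -> hausdorff_space E -> @second_countable E ->
  exists Q : nat -> set E,
    (forall n, continuity_compact (Q n)) /\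
    forall (O : set (upper_fell E)) (F : closed_sets E), open O -> O F ->
      exists n, miss (Q n) F /\ miss (Q n) `<=` O.
Proof.
move=> lcE hE [B /countable_injP[enum enum_inj] [Bopen Bbasis]].
(* an enumeration of the base, padded with the empty set *)
have [b [bopen bbasis]] : exists b : nat -> set E, (forall n, open (b n)) /\
    forall (x : E) (U : set E), nbhs x U -> exists n, b n x /\ b n `<=` U.
  have /choice[b bP] n : exists V, open V /\
      forall U, B U -> enum U = n -> V = U.
    have [[U [BU eU]]|nU] := pselect (exists U, B U /\ enum U = n).
      exists U; split=> [|W BW eW]; first exact: Bopen.
      by apply: enum_inj; rewrite ?inE// eU.
    by exists set0; split=> [|U BU eU]; [exact: open0|case: nU; exists U].
  exists b; split=> [n|x U xU]; first by have [] := bP n.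
  have [V [BV Vx] VU] := Bbasis x U xU.
  by exists (enum V); rewrite (proj2 (bP _) V).
(* q (m, n) is a continuity compact between b m and b n when there is one, and
   empty otherwise *)
have /choice[q qP] (p : nat * nat) : exists K, continuity_compact K /\
    forall L, continuity_compact L -> b p.1 `<=` L -> L `<=` b p.2 ->
      b p.1 `<=` K /\ K `<=` b p.2.
  have [[L [cL pL Lp]]|nL] := pselect (exists L,
      [/\ continuity_compact L, b p.1 `<=` L & L `<=` b p.2]).
    by exists L.
  exists set0; split; first exact: continuity_compact0.
  by move=> L cL pL Lp; case: nL; exists L.
pose Qs (s : seq (nat * nat)) := \big[setU/set0]_(p <- s) q p.
exists (fun n => Qs (odflt [::] (choice.unpickle n))); split=> [n|O F oO OF].
  by apply: continuity_compact_bigsetU => p; have [] := qP p.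
have [K [cK FK KO]] := upper_fell_base oO OF.
(* cover K by the sets b m for which q (m, n) contains b m and misses F *)
pose D := [set p | b p.1 `<=` q p /\ q p `<=` ~` (F : set E)].
have [s sD Ks] : finite_subset_cover D (fun p => b p.1) K.
  apply: (compact_finite_subset_cover cK) => [p _|x Kx]; first exact: bopen.
  have xF : nbhs x (~` (F : set E)).
    apply: open_nbhs_nbhs; split; first by rewrite openC; exact: (svalP F).
    by move=> Fx; rewrite -[False]/(set0 x) -FK; split.
  have [n [bnx bnF]] := bbasis x _ xF.
  have [L [cL xL Ln]] := continuity_compact_nbhs lcE hE
    (open_nbhs_nbhs (conj (bopen n) bnx)).
  have [m [bmx bmL]] := bbasis x _ xL.
  have [_ /(_ L cL bmL Ln)[mq qn]] := qP (m, n).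
  by exists (m, n) => //; split => //; exact: subset_trans qn bnF.
exists (choice.pickle (s : seq (nat * nat))); rewrite choice.pickleK /=; split.
  apply/seteqP; split=> // x [Fx]; rewrite /Qs -bigcup_seq => -[p ps qx].
  by have := sD p ps; rewrite inE => -[_ /(_ x qx)]; exact.
apply: subset_trans KO; apply: missS => x /Ks[p ps bx].
rewrite /Qs -bigcup_seq; exists p => //.
by have := sD p ps; rewrite inE => -[+ _]; apply.
Qed.

End continuity_compacts.

(** * The hitting events and convergence in distribution *)

Lemma hits_allC {E : topologicalType} {R : realType} {d : measure_display}
    {Omega : measurableType d} {P : probability Omega R}
    (C : random_closed_set E P) {m : nat} (K : 'I_m -> set E) :
  ~` hits_all C K = C @^-1` (\bigcup_i miss (K i)).
Proof.
apply/seteqP; split=> w /=.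
  by move=> /existsNP[i]; rewrite -[~ _]/((~` hit (K i)) (C w)) hitC; exists i.
by move=> [i _]; rewrite -hitC => nhit hall; exact: nhit (hall i).
Qed.

Lemma measurable_hits_all {E : topologicalType} {R : realType}
    {d : measure_display} {Omega : measurableType d} {P : probability Omega R}
    (C : random_closed_set E P) {m : nat} (K : 'I_m -> set E) :
  (forall i, compact (K i)) -> measurable (hits_all C K).
Proof.
move=> cK; rewrite -[hits_all C K]setCK; apply: measurableC; rewrite hits_allC.
apply: random_closed_set_measurable; apply: measurable_open_fell.
by apply: bigcup_open => i _; exact: open_fell_miss.
Qed.

Lemma probability_hits_all {E : topologicalType} {R : realType}
    {d : measure_display} {Omega : measurableType d} {P : probability Omega R}
    (C : random_closed_set E P) {m : nat} (K : 'I_m -> set E) :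
  (forall i, compact (K i)) ->
  (P (hits_all C K) = 1 - upper_law C (\bigcup_i miss (K i)))%E.
Proof.
move=> cK; rewrite -[hits_all _ _]setCK probability_setC; last first.
  by apply: measurableC; exact: measurable_hits_all.
by rewrite hits_allC.
Qed.

Section limsup_hitting.
Context {R : realType} {E : topologicalType}
  {A : Type} (le : A -> A -> Prop) (led : directed le)
  {da : A -> measure_display} {Omegaa : forall a, measurableType (da a)}
  {Pa : forall a, probability (Omegaa a) R}
  (Ca : forall a, random_closed_set E (Pa a))
  {d : measure_display} {Omega : measurableType d} {P : probability Omega R}
  (C : random_closed_set E P).

Lemma cvg_distribution_hits_all (m : nat) (K : 'I_m -> set E) :
  cvg_distribution le Ca C -> (forall i, compact (K i)) ->
  (net_limsup le (fun a => Pa a (hits_all (Ca a) K)) <= P (hits_all C K))%E.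
Proof.
move=> cvC cK; pose O : set (upper_fell E) := \bigcup_i miss (K i).
have oO : open O by apply: bigcup_open => i _; exact: open_upper_fell_miss.
have mO : measurable (O : set (borel (upper_fell E))).
  exact: sub_sigma_algebra.
have finO : upper_law C O \is a fin_num by exact: fin_num_measure.
apply/lee_addgt0Pr => e e0; apply: net_limsup_le.
have ltO : ((fine (upper_law C O) - e)%:E < upper_law C O)%E.
  by rewrite -(fineK finO) lte_fin /=; lra.
have tF := tails_filter led.
have /(weak_cvgP led)/(_ O _ oO ltO) := cvC; apply: filterS => a {}ltO.
rewrite !probability_hits_all// -/O.
have finOa : upper_law (Ca a) O \is a fin_num by exact: fin_num_measure.
move: ltO; rewrite -(fineK finO) -(fineK finOa) -!EFinB -EFinD !lee_fin lte_fin.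
by lra.
Qed.

Lemma hits_all_cvg_distribution :
  locally_compact [set: E] -> hausdorff_space E -> @second_countable E ->
  (forall (m : nat) (K : 'I_m -> set E), (0 < m)%N ->
     (forall i, compact (K i) /\ K i !=set0) ->
     (forall i, P (C @^-1` fell_boundary (hit (K i))) = 0%E) ->
     (net_limsup le (fun a => Pa a (hits_all (Ca a) K))
        <= P (hits_all C K))%E) ->
  cvg_distribution le Ca C.
Proof.
move=> lcE hE scE H; apply/(weak_cvgP led) => O r oO rO.
have tF := tails_filter led.
have [eOT|OneqT] := eqVneq O setT.
  rewrite eOT probability_setT in rO; rewrite eOT.
  by apply: filterE => a; rewrite probability_setT.
have [eO0|/set0P[F0 OF0]] := eqVneq O set0.
  rewrite eO0 measure0 in rO; rewrite eO0.
  by apply: filterE => a; rewrite measure0.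
have [Q [cQ baseQ]] := countable_continuity_compacts C lcE hE scE.
have [n0 [_ n0O]] := baseQ O F0 oO OF0.
(* the compacts Q n with miss (Q n) inside O; the other indices repeat Q n0 *)
pose L n := if `[< miss (Q n) `<=` O >] then Q n else Q n0.
have cL n : continuity_compact C (L n) by rewrite /L; case: ifPn.
have LO n : miss (L n) `<=` O by rewrite /L; case: asboolP.
(* an empty L n is missed by every closed set, which would make O full *)
have L_neq0 n : L n !=set0.
  apply/set0P/eqP => L0; case/eqP: OneqT; rewrite -subTset => F _.
  by apply: (LO n); rewrite /miss /= L0 setI0.
pose G N : set (upper_fell E) := \bigcup_(i in `I_N.+1) miss (L i).
have oG N : open (G N).
  by apply: bigcup_open => i _; apply: open_upper_fell_miss; have [] := cL i.
have GO N : G N `<=` O by apply: bigcup_sub => i _; exact: LO.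
have bigGO : \bigcup_N G N = O.
  apply/seteqP; split; first exact: bigcup_sub.
  move=> F /(baseQ O F oO)[n [Fn nO]].
  by exists n => //; exists n => //=; rewrite /L; case: asboolP.
have mopen (U : set (upper_fell E)) : open U ->
    measurable (U : set (borel (upper_fell E))) by exact: sub_sigma_algebra.
have [N rN] : exists N, (r%:E < upper_law C (G N))%E.
  have cvG : upper_law C \o G @ \oo --> upper_law C (\bigcup_N G N).
    apply: nondecreasing_cvg_mu => [i||]; first exact: mopen.
      by apply: mopen; rewrite bigGO.
    move=> i j ij; apply/subsetPset; apply: bigcup_subset => k /=.
    by move=> ki; exact: leq_trans ki _.
  rewrite bigGO in cvG.
  have : \forall N \near \oo, (r%:E < upper_law C (G N))%E.
    apply: (cvG [set x | (r%:E < x)%E]).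
    by apply: open_nbhs_nbhs; split; [exact: open_ereal_gt_ereal|].
  by case=> N _ /(_ N (leqnn N)); exists N.
pose K (i : 'I_N.+1) := L i.
have cK i : compact (K i) by have [] := cL i.
have GE : G N = \bigcup_i miss (K i).
  apply/seteqP; split=> F [i].
    by move=> /= iN ?; exists (Ordinal iN).
  by move=> _ ?; exists i => /=.
have PG d' (Omega' : measurableType d') (P' : probability Omega' R)
    (C' : random_closed_set E P') :
    (P' (hits_all C' K) = 1 - upper_law C' (G N))%E.
  by rewrite probability_hits_all// GE.
have finG d' (Omega' : measurableType d') (P' : probability Omega' R)
    (C' : random_closed_set E P') : upper_law C' (G N) \is a fin_num.
  by apply: fin_num_measure; exact: mopen.
have : (net_limsup le (fun a => Pa a (hits_all (Ca a) K)) < (1 - r)%:E)%E.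
  have cK0 i : compact (K i) /\ K i !=set0 by split; [exact: cK|exact: L_neq0].
  have nullK i : P (C @^-1` fell_boundary (hit (K i))) = 0%E by have [] := cL i.
  apply: le_lt_trans (H N.+1 K isT cK0 nullK) _.
  move: rN; rewrite PG -(fineK (@finG _ _ _ C)) -EFinB !lte_fin; lra.
move=> /net_limsup_lt; apply: filterS => a.
rewrite PG -(fineK (@finG _ _ _ (Ca a))) -EFinB !lte_fin => ra.
apply: (@lt_le_trans _ _ (upper_law (Ca a) (G N))).
  by rewrite -(fineK (@finG _ _ _ (Ca a))) lte_fin; lra.
by apply: le_measure => //; rewrite inE; exact: mopen.
Qed.

End limsup_hitting.

Theorem theorem5 (R : realType) (E : topologicalType)
  (E_nonempty : [set: E] !=set0)
  (E_locally_compact : locally_compact [set: E])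
  (E_second_countable : @second_countable E)
  (E_hausdorff : hausdorff_space E)
  (A : Type) (le : A -> A -> Prop) (le_directed : directed le)
  (da : A -> measure_display) (Omegaa : forall a, measurableType (da a))
  (Pa : forall a, probability (Omegaa a) R)
  (Ca : forall a, random_closed_set E (Pa a))
  (d : measure_display) (Omega : measurableType d) (P : probability Omega R)
  (C : random_closed_set E P) :
  [<-> cvg_distribution le Ca C;
       forall (m : nat) (K : 'I_m -> set E), (0 < m)%N ->
         (forall i, compact (K i) /\ K i !=set0) ->
         (net_limsup le (fun a => Pa a (hits_all (Ca a) K))
            <= P (hits_all C K))%E;
       forall (m : nat) (K : 'I_m -> set E), (0 < m)%N ->
         (forall i, compact (K i) /\ K i !=set0) ->
         (forall i, P (C @^-1` fell_boundary (hit (K i))) = 0%E) ->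
         (net_limsup le (fun a => Pa a (hits_all (Ca a) K))
            <= P (hits_all C K))%E].
Proof.
tfae.
- move=> cvC m K _ cK.
  by apply: cvg_distribution_hits_all => // i; have [] := cK i.
- by move=> H m K m0 cK _; exact: H.
- exact: hits_all_cvg_distribution.
Qed.
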